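(* Let $1\le p<\infty$ and let $(X,\rho)$ be a semi-normed space. Let $\{f_n\}$ be a sequence in $\mathcal{U}^p_\rho([a,b];X)$, and suppose that $\{f_n\}$ converges pointwise almost everywhere to a function $f:[a,b]\to X$. Then $$\|f\|_{\mathcal{U}^p_\rho}\le\liminf_{n\to+\infty}\|f_n\|_{\mathcal{U}^p_\rho}.$$
   Context: $[a,b]$ is a compact interval and $(X,\rho)$ is a real vector space with a semi-norm $\rho$. A gauge on $[a,b]$ is a function $\delta:[a,b]\to(0,\infty)$. A tagged partition of $[a,b]$ is a finite collection $D=\{([u_i,v_i],t_i):1\le i\le n\}$ of non-overlapping non-degenerate closed intervals with union $[a,b]$ and tags $t_i\in[u_i,v_i]$; it is $\delta$-fine if $[u_i,v_i]\subseteq(t_i-\delta(t_i),t_i+\delta(t_i))$ for every $i$. For such $D$, $(D)\sum\varphi(t)(v-u)$ denotes $\sum_{i=1}^n\varphi(t_i)(v_i-u_i)$. For any function $f:[a,b]\to X$ and $1\le p<\infty$, $$\mu^p_\rho(f,[a,b])=\inf_{\text{gauge }\delta}\ \sup\Big\{(D)\sum \rho(f(t))^p\,(v-u): D\text{ is a }\delta\text{-fine tagged partition of }[a,b]\Big\}\in[0,\infty],$$ $\|f\|_{\mathcal{U}^p_\rho}=\|f\|_{\mathcal{U}^p_\rho([a,b];X)}=\mu^p_\rho(f,[a,b])^{1/p}\in[0,\infty]$, and $\mathcal{U}^p_\rho([a,b];X)$ is the set of all $f:[a,b]\to X$ with $\mu^p_\rho(f,[a,b])<\infty$. Pointwise a.e.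 convergence of $f_n$ to $f$ means that there is a set $E\subseteq[a,b]$ of Lebesgue measure zero with $\rho(f_n(t)-f(t))\to0$ for every $t\in[a,b]\setminus E$. *)

(* Defs.v *)
From HB Require Import structures.
From mathcomp Require Import all_boot all_order all_algebra.
From mathcomp Require Import all_classical all_reals all_analysis.
Set Implicit Arguments.
Unset Strict Implicit.
Unset Printing Implicit Defensive.
Import Order.TTheory GRing.Theory Num.Theory.
Import numFieldNormedType.Exports.
Local Open Scope classical_set_scope.
Local Open Scope ring_scope.

(* MathComp's semi-normed structure is only additive (no scalar homogeneity),
   hence an explicit predicate on functions from a real vector space. *)
Record seminorm (R : realType) (X : lmodType R) (rho : X -> R) : Prop :=
  Seminorm {
    seminorm_ge0 : forall x, 0 <= rho x;
    seminormD : forall x y, rho (x + y) <= rho x + rho y;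
    seminormZ : forall (c : R) x, rho (c *: x) = `|c| * rho x
  }.

(* Functions on [a, b] are represented by total functions on R; every notion
   below depends only on their values on [a, b]. *)

Definition gauge (R : realType) (a b : R) : set (R -> R) :=
  [set delta | forall t, t \in `[a, b] -> 0 < delta t].

(* Two compact intervals are non-overlapping when their interiors are
   disjoint. *)
Record tagged_partition (R : realType) (a b : R) := TaggedPartition {
  tp_size : nat;
  tp_left : 'I_tp_size -> R;
  tp_right : 'I_tp_size -> R;
  tp_tag : 'I_tp_size -> R;
  tp_nondegenerate : forall i, tp_left i < tp_right i;
  tp_tag_in : forall i, tp_tag i \in `[tp_left i, tp_right i];
  tp_nonoverlapping : forall i j, i != j ->
    `]tp_left i, tp_right i[%classic `&` `]tp_left j, tp_right j[%classic
    = set0;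
  tp_cover :
    \bigcup_(i in [set: 'I_tp_size]) `[tp_left i, tp_right i]%classic
    = `[a, b]%classic
}.

Arguments tp_left {R a b} _ _.
Arguments tp_right {R a b} _ _.
Arguments tp_tag {R a b} _ _.

Definition fine_partition (R : realType) (a b : R) (delta : R -> R) :
    set (tagged_partition a b) :=
  [set D | forall i, `[tp_left D i, tp_right D i]%classic `<=`
     `]tp_tag D i - delta (tp_tag D i), tp_tag D i + delta (tp_tag D i)[%classic].

Definition riemann_sum (R : realType) (a b : R) (phi : R -> R)
    (D : tagged_partition a b) : R :=
  \sum_(i < tp_size D) phi (tp_tag D i) * (tp_right D i - tp_left D i).

(* The supremum is taken in [0, +oo]: adjoining 0 only matters when there is no
   fine partition, i.e. when a = b, where it makes the empty supremum 0. *)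
Definition gauge_sup (R : realType) (X : lmodType R) (rho : X -> R) (p a b : R)
    (f : R -> X) (delta : R -> R) : \bar R :=
  ereal_sup (0%E |`
    [set (riemann_sum (fun t => rho (f t) `^ p) D)%:E
       | D in @fine_partition R a b delta]).

Definition mu_rho (R : realType) (X : lmodType R) (rho : X -> R) (p a b : R)
    (f : R -> X) : \bar R :=
  ereal_inf [set gauge_sup rho p a b f delta | delta in gauge a b].

Definition Unorm (R : realType) (X : lmodType R) (rho : X -> R) (p a b : R)
    (f : R -> X) : \bar R :=
  (mu_rho rho p a b f `^ p^-1)%E.

Definition Uspace (R : realType) (X : lmodType R) (rho : X -> R) (p a b : R) :
    set (R -> X) :=
  [set f | (mu_rho rho p a b f < +oo)%E].

Definition cvg_ae (R : realType) (X : lmodType R) (rho : X -> R) (a b : R)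
    (f_ : nat -> R -> X) (f : R -> X) : Prop :=
  exists E : set R,
    [/\ E `<=` `[a, b]%classic,
        (@lebesgue_measure R).-negligible E &
        forall t, t \in `[a, b] -> ~ E t ->
          rho (f_ n t - f t) @[n --> \oo] --> (0 : R)].

(* Main.v *)
(* The upper gauge integral of a nonnegative function g is the infimum of F b
   over the major functions F of g: nondecreasing F with F a = 0 whose
   increments over small intervals tagged at t dominate g t times the length.
   From a gauge, the supremum of the fine sums over [a, x] is such an F.
   No measurability is involved, so monotone convergence can be proved directly
   by combining major functions of the terms, and Fatou's lemma follows by
   applying it to the infima of rho (f_m t) ^ p over m >= n, replaced by the
   constant n on the exceptional null set E, where n * 1_E has major functions
   with arbitrarily small increment. *)
Require Import Defs.
From HB Require Import structures.
From mathcomp Require Import all_boot all_order all_algebra.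
From mathcomp Require Import all_classical all_reals all_analysis.
From mathcomp Require Import ring lra.
Set Implicit Arguments.
Unset Strict Implicit.
Import Order.TTheory GRing.Theory Num.Theory.
Import numFieldNormedType.Exports.
Local Open Scope classical_set_scope.
Local Open Scope ring_scope.

(** * Major functions and the upper primitive *)

Definition nondec_on (R : realType) (a b : R) (F : R -> R) : Prop :=
  forall u v, a <= u -> u <= v -> v <= b -> F u <= F v.

(** The tag may be an endpoint ([u = t] or [v = t]), so an interval around [t] can be cut at its
    tag. *)
Definition major (R : realType) (a b : R) (g F : R -> R) : Prop :=
  [/\ F a = 0, nondec_on a b F &
    forall t, a <= t -> t <= b -> exists2 d : R, 0 < d &
      forall u v, a <= u -> u <= t -> t <= v -> v <= b ->
        t - d < u -> v < t + d -> g t * (v - u) <= F v - F u].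

(** When a major function exists this is the indefinite upper integral of [g]; otherwise [inf] takes
    a default value, hence the witness [F] in the lemmas below. *)
Definition upper_primitive (R : realType) (a b : R) (g : R -> R) (x : R) : R :=
  inf [set F x | F in [set F | major a b g F]].

Lemma major_ge0 (R : realType) (a b : R) (g F : R -> R) (x : R) :
  major a b g F -> a <= x -> x <= b -> 0 <= F x.
Proof. by case=> Fa F_nd _ ax xb; rewrite -Fa; exact: F_nd. Qed.

Lemma major_le (R : realType) (a b : R) (g h F : R -> R) :
  (forall t, a <= t -> t <= b -> g t <= h t) ->
  major a b h F -> major a b g F.
Proof.
move=> gh [Fa F_nd F_maj]; split=> // t at_ tb.
have [d d0 Fd] := F_maj t at_ tb; exists d => // u v au ut tv vb du vd.
apply: le_trans (Fd u v au ut tv vb du vd).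
by rewrite ler_wpM2r ?gh// subr_ge0 (le_trans ut).
Qed.

(** Away from [c] the radius is shrunk so that [u] and [v] stay on one side of [c]; at the tag [c]
    the interval is cut and each half is charged to its own function. *)
Lemma major_glue (R : realType) (a b : R) (g F H : R -> R) (c : R) :
  a <= c -> c <= b -> major a b g F -> major a b g H ->
  major a b g (fun x => if x <= c then H x else H c + F x - F c).
Proof.
move=> ac cb [Fa F_nd F_maj] [Ha H_nd H_maj]; split.
- by rewrite ac.
- move=> u v au uv vb; case: (leP u c) => uc; case: (leP v c) => vc.
  + exact: H_nd.
  + have := H_nd u c au uc cb; have := F_nd c v ac (ltW vc) vb; lra.
  + lra.
  + have := F_nd u v au uv vb; lra.
- move=> t at_ tb.
  have [d1 d10 F1] := F_maj t at_ tb; have [d2 d20 H1] := H_maj t at_ tb.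
  have [tc|ct|tc] := ltgtP t c.
  + exists (Num.min d2 (c - t)); first by rewrite lt_min d20 subr_gt0.
    move=> u v au ut tv vb; rewrite ltrBlDr -ltrBlDl lt_min => /andP[u1 u2].
    rewrite -ltrBlDl lt_min => /andP[v1 v2].
    have -> : u <= c by lra.
    have -> : v <= c by lra.
    apply: H1 => //; lra.
  + exists (Num.min d1 (t - c)); first by rewrite lt_min d10 subr_gt0.
    move=> u v au ut tv vb; rewrite ltrBlDr -ltrBlDl lt_min => /andP[u1 u2].
    rewrite -ltrBlDl lt_min => /andP[v1 v2].
    have -> : (u <= c) = false by apply/negbTE; rewrite -ltNge; lra.
    have -> : (v <= c) = false by apply/negbTE; rewrite -ltNge; lra.
    have : g t * (v - u) <= F v - F u by apply: F1 => //; lra.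
    lra.
  + subst t.
    exists (Num.min d1 d2); first by rewrite lt_min d10.
    move=> u v au ut tv vb; rewrite ltrBlDr -ltrBlDl lt_min => /andP[u1 u2].
    rewrite -ltrBlDl lt_min => /andP[v1 v2].
    rewrite ut.
    have A : g c * (c - u) <= H c - H u by apply: H1 => //; lra.
    have B : g c * (v - c) <= F v - F c by apply: F1 => //; lra.
    case: (leP v c) => vc; last by lra.
    by rewrite (_ : v = c)//; apply/eqP; rewrite eq_le vc.
Qed.

Lemma upper_primitive_le (R : realType) (a b : R) (g F : R -> R) (x : R) :
  major a b g F -> a <= x -> x <= b -> upper_primitive a b g x <= F x.
Proof.
move=> F_maj ax xb; apply: ge_inf; last by exists F.
by exists 0 => _ [H H_maj <-]; exact: major_ge0 H_maj ax xb.
Qed.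

Lemma upper_primitive_adherent (R : realType) (a b : R) (g F : R -> R) (x e : R) :
  major a b g F -> a <= x -> x <= b -> 0 < e ->
  exists2 H, major a b g H & H x < upper_primitive a b g x + e.
Proof.
move=> F_maj ax xb e0.
have [|_ [H H_maj <-] He] := @inf_adherent _ [set F x | F in [set F | major a b g F]] _ e0.
  split; first by exists (F x), F.
  by exists 0 => _ [H H_maj <-]; exact: major_ge0 H_maj ax xb.
by exists H.
Qed.

Lemma upper_primitive_start (R : realType) (a b : R) (g F : R -> R) :
  a <= b -> major a b g F -> upper_primitive a b g a = 0.
Proof.
move=> ab F_maj; have [Fa _ _] := F_maj.
rewrite /upper_primitive (_ : [set _ | _ in _] = [set 0]) ?inf1//.
by apply/seteqP; split => [_ [H [Ha _ _] <-]|_ ->]; [|exists F].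
Qed.

(* A better major function on [a, u], continued by F beyond u, is again major. *)
Lemma major_sub_upper_primitive_nondec (R : realType) (a b : R) (g F : R -> R) :
  major a b g F -> nondec_on a b (fun x => F x - upper_primitive a b g x).
Proof.
move=> F_maj u v au uv vb.
have ub : u <= b by exact: le_trans uv vb.
have av : a <= v by exact: le_trans au uv.
apply/ler_addgt0Pr => e e0.
have [H H_maj He] := upper_primitive_adherent F_maj au ub e0.
have := upper_primitive_le (major_glue au ub F_maj H_maj) av vb.
case: (leP v u) => vu; last by lra.
have -> : v = u by apply/eqP; rewrite eq_le vu.
lra.
Qed.

(** A major function of [h] that is nearly optimal at [v] is also major for [g], so subtracting the
    upper primitive of [g] from it leaves a nondecreasing function. *)
Lemma upper_primitive_mono (R : realType) (a b : R) (g h F : R -> R) :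
  (forall t, a <= t -> t <= b -> g t <= h t) -> major a b h F ->
  nondec_on a b (fun x => upper_primitive a b h x - upper_primitive a b g x).
Proof.
move=> gh F_maj u v au uv vb.
have ub : u <= b by exact: le_trans uv vb.
have av : a <= v by exact: le_trans au uv.
apply/ler_addgt0Pr => e e0.
have [H H_maj He] := upper_primitive_adherent F_maj av vb e0.
have := major_sub_upper_primitive_nondec (major_le gh H_maj) au uv vb.
have := upper_primitive_le H_maj au ub.
lra.
Qed.

(** * Monotone limits of integrands *)

Lemma nondec_sup (R : realType) (a b C : R) (P : nat -> R -> R) :
  a <= b -> (forall n, P n a = 0) -> nondec_on a b (P 0%N) ->
  (forall n, nondec_on a b (fun x => P n.+1 x - P n x)) ->
  (forall n, P n b <= C) ->
  exists G : R -> R, [/\ G a = 0, G b <= C &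
    forall n, nondec_on a b (fun x => G x - P n x)].
Proof.
move=> ab Pa P0 PS Pb.
have PD m n : (m <= n)%N -> nondec_on a b (fun x => P n x - P m x).
  move=> mn u v au uv vb; elim: n mn => [|n IH].
    by rewrite leqn0 => /eqP ->; rewrite !subrr.
  rewrite leq_eqVlt => /orP[/eqP ->|/IH]; first by rewrite !subrr.
  have := PS n u v au uv vb; lra.
have Pnd n : nondec_on a b (P n).
  move=> u v au uv vb; have := PD 0%N n (leq0n n) u v au uv vb.
  have := P0 u v au uv vb; lra.
have Pub x : a <= x -> x <= b -> has_ubound (range (P ^~ x)).
  move=> ax xb; exists C => _ [n _ <-].
  by apply: le_trans (Pb n); exact: Pnd.
exists (fun x => sup (range (P ^~ x))); split.
- have -> : range (P ^~ a) = [set 0]; last exact: sup1.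
  by apply/seteqP; split => [_ [n _ <-]|_ ->]; [exact: Pa | exists 0%N].
- apply: ge_sup; first by exists (P 0%N b), 0%N.
  by move=> _ [n _ <-].
- move=> n u v au uv vb.
  have ub : u <= b by exact: le_trans uv vb.
  have av : a <= v by exact: le_trans au uv.
  rewrite lerBlDr; apply: ge_sup; first by exists (P 0%N u), 0%N.
  (* Past both indices, [P m u <= P k u] because [P k - P m] is nondecreasing and vanishes at [a],
     and [P k] grows at least as much as [P n] on [[u, v]]. *)
  move=> _ [m _ <-]; pose k := maxn m n.
  have Gk : P k v <= sup (range (P ^~ v)) by apply: ub_le_sup; [exact: Pub|exists k].
  have := PD _ _ (leq_maxl m n) a u (lexx a) au ub.
  have := PD _ _ (leq_maxr m n) u v au uv vb.
  rewrite !Pa -/k; lra.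
Qed.

(* Henstock's lemma makes every [F k - upper_primitive (h k)] nondecreasing
   with total increment at most [e / 2 ^ k.+1]; these increments dominate the
   error made by using [F k] only near the points where [h k] is close to [g]. *)
Lemma major_monotone_limit (R : realType) (a b M : R) (h : nat -> R -> R)
    (g : R -> R) :
  a <= b ->
  (forall n t, a <= t -> t <= b -> h n t <= h n.+1 t) ->
  (forall n (e : R), 0 < e -> exists2 F, major a b (h n) F & F b <= M + e) ->
  (forall t (e : R), a <= t -> t <= b -> 0 < e -> exists n, g t <= h n t + e) ->
  forall e : R, 0 < e -> exists2 G, major a b g G & G b <= M + e.
Proof.
move=> ab h_nd h_maj h_lim e e0.
pose U n := upper_primitive a b (h n).
have exF n : exists F, major a b (h n) F /\ F b < U n b + e / 2 ^+ n.+2.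
  have [F0 F0_maj _] := h_maj n 1 ltr01.
  have en : 0 < e / 2 ^+ n.+2 by rewrite divr_gt0// exprn_gt0.
  by have [F ? ?] := upper_primitive_adherent F0_maj ab (lexx b) en; exists F.
have /choice[F F_prop] := exF.
have F_maj n : major a b (h n) (F n) by case: (F_prop n).
have Ua n : U n a = 0 by exact: upper_primitive_start (F_maj n).
have UM n : U n b <= M.
  apply/ler_addgt0Pr => e' /(h_maj n)[H H_maj]; apply: le_trans.
  exact: upper_primitive_le.
have FU n : nondec_on a b (fun x => F n x - U n x).
  exact: major_sub_upper_primitive_nondec.
have UU n : nondec_on a b (fun x => U n.+1 x - U n x).
  by apply: upper_primitive_mono (F_maj n.+1); exact: h_nd.
(* Adding the errors [F k - U k] of the earlier terms to [U n] makes [P n] dominate the increments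
   of every [F k] with [k < n]. *)
pose P n x := \sum_(k < n) (F k x - U k x) + U n x.
have PS n x : P n.+1 x - P n x = (F n x - U n x) + (U n.+1 x - U n x).
  by rewrite /P big_ord_recr /=; ring.
have [||||G [Ga Gb GP]] := @nondec_sup _ a b (M + e / 2) P ab.
- move=> n; rewrite /P Ua addr0 big1// => k _.
  by case: (F_maj k) => -> _ _; rewrite Ua subrr.
- move=> u v au uv vb; rewrite /P !big_ord0 !add0r.
  have av : a <= v by exact: le_trans au uv.
  have ub : u <= b by exact: le_trans uv vb.
  apply/ler_addgt0Pr => e' e'0.
  have [H H_maj He] := upper_primitive_adherent (F_maj 0%N) av vb e'0.
  have := upper_primitive_le H_maj au ub.
  case: H_maj => _ /(_ u v au uv vb) Huv _.
  rewrite /U; lra.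
- move=> n u v au uv vb; rewrite !PS.
  by rewrite lerD//; [exact: FU | exact: UU].
- move=> n; rewrite /P addrC lerD//.
  (* Geometric series: the error of index [k] is below [e / 2 ^+ k.+2], which spends half of [e]. *)
  suff : \sum_(k < n) (F k b - U k b) <= e / 2 - e / 2 ^+ n.+1.
    move/le_trans; apply; rewrite gerBl.
    by apply/ltW; rewrite divr_gt0// exprn_gt0.
  elim: n => [|n IH]; first by rewrite big_ord0 expr1 subrr.
  rewrite big_ord_recr /=; have := (F_prop n).2.
  have : e / 2 ^+ n.+1 = 2 * (e / 2 ^+ n.+2).
    by rewrite (exprS _ n.+1) invfM mulrCA mulVKf ?pnatr_eq0.
  lra.
(* The other half of [e] pays, through a linear term of slope [s], for replacing [h n t] by [g t];
   the [+ 1] keeps the denominator positive when [a = b]. *)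
pose s := e / 2 / (b - a + 1).
have s0 : 0 < s by rewrite /s !divr_gt0//; lra.
have sE : s * (b - a) <= e / 2.
  rewrite /s mulrAC ler_pdivrMr; last by lra.
  by rewrite ler_pM2l; lra.
exists (fun x => G x + s * (x - a)); last by lra.
(* [P n.+1 - F n] is the sum of [P n - U n] and [U n.+1 - U n], both nondecreasing. *)
have GF n : nondec_on a b (fun x => G x - F n x).
  move=> u v au uv vb; have := GP n.+1 u v au uv vb.
  have PE x : P n.+1 x = P n x + F n x - U n x + (U n.+1 x - U n x).
    by have := PS n x; lra.
  have Pn : P n u - U n u <= P n v - U n v.
    rewrite /P !addrK; apply: ler_sum => k _; exact: FU.
  have := UU n u v au uv vb; rewrite !PE; lra.
split.
- by rewrite Ga; ring.
- move=> u v au uv vb; rewrite lerD// ?ler_pM2l// ?lerD2r//.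
  have := GF 0%N u v au uv vb; have [_ /(_ u v au uv vb)] := F_maj 0%N; lra.
- move=> t at_ tb; have [n gh] := h_lim t s at_ tb s0.
  have [_ _ /(_ t at_ tb)[d d0 Fd]] := F_maj n.
  exists d => // u v au ut tv vb du vd.
  have uv : u <= v by exact: le_trans tv.
  have := Fd u v au ut tv vb du vd; have := GF n u v au uv vb.
  have : g t * (v - u) <= (h n t + s) * (v - u) by rewrite ler_wpM2r// subr_ge0.
  lra.
Qed.

(** * From a major function to a gauge *)

Lemma sum_increments_le (R : realType) (a b : R) (F : R -> R) (n : nat)
    (l r : 'I_n -> R) (S : {set 'I_n}) (c : R) :
  nondec_on a b F -> (forall i, l i < r i) -> (forall i, a <= l i) ->
  (forall i j, i != j -> `]l i, r i[%classic `&` `]l j, r j[%classic = set0) ->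
  a <= c -> c <= b -> (forall i, i \in S -> r i <= c) ->
  \sum_(i in S) (F (r i) - F (l i)) <= F c - F a.
Proof.
move=> F_nd lr al disj.
elim: {S}_.+1 {-2}S (ltnSn #|S|) c => // m IH S; rewrite ltnS => Sm c ac cb rc.
have [->|[i0 i0S]] := set_0Vmem S.
  by rewrite big_set0 subr_ge0; exact: F_nd.
(* Induction on the cardinal: the interval with the largest left end is removed, and the others end
   at or before [l i], which becomes the new bound [c]. *)
have [i iS imax] := @arg_maxP _ _ _ i0 (mem S) l i0S.
have {}iS : i \in S by [].
rewrite (big_setD1 i)//=.
have rl j : j \in S :\ i -> r j <= l i.
  rewrite !inE => /andP[ji jS]; rewrite leNgt; apply/negP => lir.
  have lji : l j <= l i by exact: imax.
  (* This midpoint would lie in the interiors of both intervals. *)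
  pose z := (l i + Num.min (r i) (r j)) / 2.
  have mi : Num.min (r i) (r j) <= r i by rewrite ge_min lexx.
  have mj : Num.min (r i) (r j) <= r j by rewrite ge_min lexx orbT.
  have lm : l i < Num.min (r i) (r j) by rewrite lt_min lr.
  suff : (`]l j, r j[%classic `&` `]l i, r i[%classic) z.
    by rewrite disj.
  by split; rewrite /= in_itv /= /z; apply/andP; split; lra.
have lib : l i <= b by apply: le_trans (le_trans (rc i iS) cb); exact: ltW.
have Sm' : (#|S :\ i| < m)%N by move: Sm; rewrite (cardsD1 i S) iS.
have := IH _ Sm' (l i) (al i) lib rl.
have := F_nd (r i) c (le_trans (al i) (ltW (lr i))) (rc i iS) cb.
lra.
Qed.

Lemma riemann_sum_le_major (R : realType) (a b : R) (g F delta : R -> R)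
    (D : tagged_partition a b) :
  nondec_on a b F ->
  (forall t u v, a <= u -> u <= t -> t <= v -> v <= b ->
     t - delta t < u -> v < t + delta t -> g t * (v - u) <= F v - F u) ->
  fine_partition delta D -> a <= b -> riemann_sum g D <= F b - F a.
Proof.
move=> F_nd F_delta D_fine ab.
have D_sub i : a <= tp_left D i /\ tp_right D i <= b.
  have sub x : tp_left D i <= x <= tp_right D i -> a <= x <= b.
    move=> xi; have : `[a, b]%classic x.
      by rewrite -(tp_cover D); exists i => //; rewrite /= in_itv.
    by rewrite /= in_itv.
  have := tp_nondegenerate i => /ltW lr.
  have := sub (tp_left D i); have := sub (tp_right D i).
  by rewrite !lexx lr /= => /(_ isT)/andP[_ ->] /(_ isT)/andP[-> _].
have : \sum_(i in finset xpredT) (F (tp_right D i) - F (tp_left D i)) <= F b - F a.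
  apply: (sum_increments_le F_nd) => //.
  - by move=> i; exact: tp_nondegenerate.
  - by move=> i; case: (D_sub i).
  - exact: tp_nonoverlapping.
  - by move=> i _; case: (D_sub i).
apply: le_trans; rewrite /riemann_sum; under [leRHS]eq_bigl do rewrite inE.
apply: ler_sum => i _; have [al rb] := D_sub i.
have /ltW lr := tp_nondegenerate i.
have := tp_tag_in i; rewrite in_itv /= => /andP[lt tr].
have fine x : tp_left D i <= x <= tp_right D i ->
    tp_tag D i - delta (tp_tag D i) < x < tp_tag D i + delta (tp_tag D i).
  by move=> xi; have := D_fine i x; rewrite /= !in_itv /=; apply.
apply: F_delta => //.
  by have := fine (tp_left D i); rewrite lexx lr => /(_ isT)/andP[].
by have := fine (tp_right D i); rewrite lexx lr => /(_ isT)/andP[].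
Qed.

(** The local radii attached to [F] are collected by choice into one gauge, for which every fine sum
    is at most [F b]. *)
Lemma mu_rho_le_major (R : realType) (X : lmodType R) (rho : X -> R)
    (p a b : R) (f : R -> X) (F : R -> R) :
  a <= b -> major a b (fun t => rho (f t) `^ p) F ->
  (mu_rho rho p a b f <= (F b)%:E)%E.
Proof.
move=> ab F_maj; have [Fa F_nd F_loc] := F_maj.
have /choice[delta delta_prop] : forall t, exists d : R, a <= t -> t <= b ->
    0 < d /\ forall u v, a <= u -> u <= t -> t <= v -> v <= b ->
      t - d < u -> v < t + d -> rho (f t) `^ p * (v - u) <= F v - F u.
  move=> t; case: (boolP (a <= t <= b)) => [/andP[at_ tb]|tab].
    by have [d d0 Fd] := F_loc t at_ tb; exists d.
  (* A gauge is unconstrained outside [[a, b]], so 0 serves as a default radius. *)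
  by exists 0 => at_ tb; rewrite at_ tb in tab.
apply: ereal_inf_le.
exists (gauge_sup rho p a b f delta).
  exists delta => // t; rewrite in_itv /= => /andP[at_ tb].
  by case: (delta_prop t at_ tb).
apply: ge_ereal_sup => _ [->|[D D_fine <-]].
  by rewrite lee_fin (major_ge0 F_maj).
rewrite lee_fin -[F b]subr0 -Fa; apply: riemann_sum_le_major D_fine ab => //.
move=> t u v au ut tv vb; apply: (delta_prop _ _ _).2 => //.
  exact: le_trans ut.
exact: le_trans vb.
Qed.

(** * From a gauge to a major function *)

(** Division points are listed in increasing order so that an interval can be appended on the right;
    [n = 0] is allowed and covers [x = a]. *)
Definition chain_sum (R : realType) (a : R) (delta g : R -> R) (x s : R) : Prop :=
  exists n (q t : nat -> R), [/\ q 0%N = a, q n = x,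
    forall i, (i < n)%N -> [/\ q i < q i.+1, q i <= t i, t i <= q i.+1,
      t i - delta (t i) < q i & q i.+1 < t i + delta (t i)] &
    s = \sum_(i < n) g (t i) * (q i.+1 - q i)].

Lemma chain_sum0 (R : realType) (a : R) (delta g : R -> R) :
  chain_sum a delta g a 0.
Proof. by exists 0%N, (fun=> a), (fun=> a); split=> //; rewrite big_ord0. Qed.

Lemma chain_sum_start (R : realType) (a : R) (delta g : R -> R) (s : R) :
  chain_sum a delta g a s -> s = 0.
Proof.
move=> [[|n] [q [t [q0 qn q_step ->]]]]; first by rewrite big_ord0.
have : forall m, (m <= n)%N -> q 0%N < q m.+1.
  elim=> [_|m IH mn]; first by case: (q_step 0%N).
  by apply: lt_trans (IH (ltnW mn)) _; case: (q_step m.+1).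
by move/(_ n (leqnn n)); rewrite q0 qn ltxx.
Qed.

Lemma chain_sum_step (R : realType) (a : R) (delta g : R -> R) (x y s t : R) :
  chain_sum a delta g x s -> x < y -> x <= t -> t <= y ->
  t - delta t < x -> y < t + delta t ->
  chain_sum a delta g y (s + g t * (y - x)).
Proof.
move=> [n [q [tau [q0 qn q_step ->]]]] xy xt ty tx yt.
exists n.+1, (fun i => if (i <= n)%N then q i else y),
  (fun i => if (i < n)%N then tau i else t); split=> //.
- by rewrite ltnn.
- move=> i; rewrite ltnS => in1.
  have /orP[/eqP ->|i_n] : (i == n) || (i < n)%N by rewrite -leq_eqVlt.
    by rewrite leqnn !ltnn qn; split.
  by rewrite in1 i_n; exact: q_step.
- rewrite big_ord_recr /= leqnn !ltnn qn; congr (_ + _).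
  by apply: eq_bigr => i _; rewrite (ltnW (ltn_ord i)) ltn_ord.
Qed.

(* Cousin's lemma *)
Lemma chain_sum_extend (R : realType) (a b : R) (delta g : R -> R) (u v s : R) :
  (forall t, a <= t -> t <= b -> 0 < delta t) -> (forall t, 0 <= g t) ->
  a <= u -> u <= v -> v <= b -> chain_sum a delta g u s ->
  exists2 s', s <= s' & chain_sum a delta g v s'.
Proof.
move=> delta0 g0 au uv vb us.
(* The points reachable from [u] without lowering the sum; the aim is to reach [v]. *)
pose A := [set y | u <= y <= v /\ exists2 s', s <= s' & chain_sum a delta g y s'].
have Au : A u by split; [rewrite lexx|exists s].
have Aub : has_ubound A by exists v => y [/andP[]].
pose c := sup A.
have uc : u <= c by exact: ub_le_sup.
have cv : c <= v by apply: ge_sup; [exists u|move=> y [/andP[]]].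
have dc : 0 < delta c by apply: delta0; [exact: le_trans uc|exact: le_trans cv vb].
have [|y [/andP[uy yv] [s1 ss1 ys1]] cy] := @sup_adherent _ A (delta c) dc.
  by split; first by exists u.
have yc : y <= c by apply: ub_le_sup => //; split; [rewrite uy|exists s1].
(* [w] passes [c] by half the radius at [c], capped at [v]. The interval [[y, w]] tagged at [c] is
   fine, so [w] is reachable, and [w <= c] then forces [w = v]. *)
pose w := Num.min v (c + delta c / 2).
have cw : c <= w by rewrite le_min cv; lra.
have wc : w < c + delta c by rewrite gt_min; apply/orP; right; lra.
have wv : w <= v by rewrite ge_min lexx.
have Aw : A w.
  split; first by rewrite wv (le_trans uc).
  have [yw|wy] := ltP y w; last first.
    by exists s1 => //; rewrite (_ : w = y)//; apply/eqP; rewrite eq_le wy (le_trans yc).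
  exists (s1 + g c * (w - y)).
    have : 0 <= g c * (w - y) by rewrite mulr_ge0// subr_ge0 ltW.
    lra.
  exact: chain_sum_step.
have : w <= c by exact: ub_le_sup.
rewrite /w ge_min => /orP[vc|]; last by lra.
have vw : w = v by apply/eqP; rewrite eq_le wv /w le_min lexx; lra.
by rewrite vw in Aw; case: Aw.
Qed.

Lemma chain_sum_partition (R : realType) (a b s : R) (delta g : R -> R) :
  a < b -> chain_sum a delta g b s ->
  exists2 D : tagged_partition a b, fine_partition delta D & riemann_sum g D = s.
Proof.
move=> ab [n [q [t [q0 qn q_step ->]]]].
have q_mono i j : (i <= j)%N -> (j <= n)%N -> q i <= q j.
  elim: j => [|j IH]; first by rewrite leqn0 => /eqP ->.
  rewrite leq_eqVlt => /orP[/eqP ->//|ij] jn.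
  apply: le_trans (IH ij (ltnW jn)) _.
  by case: (q_step j jn) => /ltW.
have n0 : (0 < n)%N by case: n qn {q_step q_mono} => // q0'; move: ab; rewrite -q0 -q0' ltxx.
have H1 (i : 'I_n) : q i < q i.+1 by case: (q_step i).
have H2 (i : 'I_n) : t i \in `[q i, q i.+1].
  by rewrite in_itv /=; case: (q_step i (ltn_ord i)) => _ -> ->.
have H3 (i j : 'I_n) : i != j ->
    `]q i, q i.+1[%classic `&` `]q j, q j.+1[%classic = set0.
  move=> ij; apply/seteqP; split=> // z [] /=; rewrite !in_itv /=.
  move=> /andP[iz zi] /andP[jz zj].
  have [ij'|ji|/val_inj] := ltngtP i j; last by apply/eqP.
    by have := q_mono _ _ ij' (ltnW (ltn_ord j)); lra.
  by have := q_mono _ _ ji (ltnW (ltn_ord i)); lra.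
have H4 : \bigcup_(i in [set: 'I_n]) `[q i, q i.+1]%classic = `[a, b]%classic.
  apply/seteqP; split=> [z [i _]|z] /=; rewrite !in_itv /= => /andP[z1 z2].
    apply/andP; split; first by rewrite -q0 (le_trans _ z1)// q_mono// ltnW.
    by rewrite -qn (le_trans z2)// q_mono.
  (* Induction on the index of a division point at or beyond [z] locates an interval containing
     [z]. *)
  have : forall m, (0 < m)%N -> (m <= n)%N -> z <= q m ->
      exists2 i : 'I_n, True & q i <= z <= q i.+1.
    elim=> // -[_ _ n0' zq|m IH _ mn zq].
      by exists (Ordinal n0') => //=; rewrite q0 z1.
    have [zm|mz] := leP z (q m.+1); first exact: IH (ltnW mn) zm.
    by exists (Ordinal mn) => //=; rewrite zq ltW.
  by move=> /(_ n n0 (leqnn n)); rewrite qn => /(_ z2)[i _ zi]; exists i => //=; rewrite in_itv.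
exists (TaggedPartition H1 H2 H3 H4) => // i z /=; rewrite !in_itv /= => /andP[z1 z2].
by have [_ _ _ ? ?] := q_step i (ltn_ord i); apply/andP; split; lra.
Qed.

(* The major function is the supremum of the sums over fine partitions of [a, x]. *)
Lemma major_of_mu_rho_lt (R : realType) (X : lmodType R) (rho : X -> R)
    (p a b : R) (f : R -> X) (M : R) :
  a <= b -> (mu_rho rho p a b f < M%:E)%E ->
  exists2 F, major a b (fun t => rho (f t) `^ p) F & F b <= M.
Proof.
move=> ab /ereal_inf_lt[_ [delta delta_gauge <-] sup_lt].
pose g t := rho (f t) `^ p.
have g0 t : 0 <= g t by exact: powR_ge0.
have delta0 t : a <= t -> t <= b -> 0 < delta t.
  by move=> at_ tb; apply: delta_gauge; rewrite in_itv /= at_.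
have sum_le s : chain_sum a delta g b s -> s <= M.
  move=> bs; rewrite -lee_fin; apply: le_trans (ltW sup_lt).
  have [ab'|ba] := ltP a b.
    have [D D_fine <-] := chain_sum_partition ab' bs.
    by apply: ereal_sup_ubound; right; exists D.
  (* For [a = b] only the empty chain remains; its sum is the 0 adjoined in [gauge_sup]. *)
  apply: ereal_sup_ubound; left; congr EFin.
  have ba' : b = a by apply/eqP; rewrite eq_le ba.
  by rewrite ba' in bs; exact: chain_sum_start bs.
pose F x := sup [set s | chain_sum a delta g x s].
have ne x : a <= x -> x <= b -> [set s | chain_sum a delta g x s] !=set0.
  move=> ax xb.
  by have [s _ xs] := chain_sum_extend delta0 g0 (lexx a) ax xb (chain_sum0 a delta g); exists s.
have ub x : a <= x -> x <= b -> has_ubound [set s | chain_sum a delta g x s].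
  move=> ax xb; exists M => s xs.
  have [s' ss' bs'] := chain_sum_extend delta0 g0 ax xb (lexx b) xs.
  exact: le_trans ss' (sum_le _ bs').
have F_nd : nondec_on a b F.
  move=> u v au uv vb.
  have ub' : u <= b by exact: le_trans uv vb.
  apply: ge_sup; first exact: ne.
  move=> s us; have [s' ss' vs'] := chain_sum_extend delta0 g0 au uv vb us.
  by apply: le_trans ss' _; apply: ub_le_sup => //; apply: ub => //; exact: le_trans uv.
exists F; last by apply: ge_sup; [exact: ne|exact: sum_le].
split=> //.
- have Fa0 : 0 <= F a by apply: ub_le_sup; [exact: ub|exact: chain_sum0].
  apply/eqP; rewrite eq_le Fa0 andbT; apply: ge_sup; first exact: ne.
  by move=> s /chain_sum_start ->.
- move=> t at_ tb; exists (delta t); first exact: delta0.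
  move=> u v au ut tv vb tu vt.
  have [uv|vu] := ltP u v; last first.
    by rewrite (_ : u = v) ?subrr ?mulr0//; apply/eqP; rewrite eq_le vu (le_trans ut).
  (* Appending [[u, v]] tagged at [t] to any chain ending at [u] gives a chain ending at [v]. *)
  rewrite -/(g t) lerBrDr addrC -lerBrDr; apply: ge_sup.
    by apply: ne => //; exact: le_trans ut tb.
  move=> s us; rewrite lerBrDr; apply: ub_le_sup; first by apply: ub => //; exact: le_trans at_ tv.
  exact: chain_sum_step.
Qed.

(** * Sums of major functions and null sets *)

Lemma majorD (R : realType) (a b : R) (g h F H : R -> R) :
  major a b g F -> major a b h H ->
  major a b (fun t => g t + h t) (fun x => F x + H x).
Proof.
move=> [Fa F_nd F_maj] [Ha H_nd H_maj]; split.
- by rewrite Fa Ha addr0.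
- by move=> u v au uv vb; rewrite lerD ?F_nd ?H_nd.
- move=> t at_ tb.
  have [d1 d10 F1] := F_maj t at_ tb; have [d2 d20 H1] := H_maj t at_ tb.
  exists (Num.min d1 d2); first by rewrite lt_min d10.
  move=> u v au ut tv vb; rewrite ltrBlDr -ltrBlDl lt_min => /andP[u1 u2].
  rewrite -ltrBlDl lt_min => /andP[v1 v2].
  have : g t * (v - u) <= F v - F u by apply: F1 => //; lra.
  have : h t * (v - u) <= H v - H u by apply: H1 => //; lra.
  lra.
Qed.

(* [F x] is [c] times the measure of the part of a small open neighbourhood of
   [E] lying in ]a, x]. *)
Lemma major_negligible (R : realType) (a b c e : R) (E : set R) :
  0 <= c -> 0 < e -> (@lebesgue_measure R).-negligible E ->
  exists2 F, major a b (fun t => if t \in E then c else 0) F & F b <= e.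
Proof.
move=> c0 e0 [B [mB B0 EB]].
pose eps := e / (c + 1).
have eps0 : 0 < eps by rewrite divr_gt0//; lra.
have Boo : (lebesgue_measure B < +oo)%E by rewrite [lebesgue_measure B]B0 ltry.
have [U [oU BU Ueps]] := lebesgue_regularity_outer mB Boo eps0.
have mU : measurable U by exact: measurable_realfun.open_measurable.
pose mu := @lebesgue_measure R.
have muU : (mu U <= eps%:E)%E.
  have -> : U = B `|` (U `\` B) by rewrite setDUK.
  apply: le_trans (measureU2 _ mB (measurableD mU mB)) _.
  rewrite [X in (X + _)%E](_ : _ = 0%E); last exact: B0.
  by rewrite add0e ltW.
have meas_I u v : measurable (U `&` `]u, v]%classic) by exact: measurableI.
have le_I u v : (mu (U `&` `]u, v]%classic) <= eps%:E)%E.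
  by apply: le_trans muU; apply: le_measure; [by rewrite inE; exact: meas_I|by rewrite inE|exact: subIsetl].
have fin_I u v : mu (U `&` `]u, v]%classic) \is a fin_num.
  by rewrite ge0_fin_numE ?measure_ge0// (le_lt_trans (le_I u v))// ltry.
pose N u v := fine (mu (U `&` `]u, v]%classic)).
have N0 u v : 0 <= N u v by rewrite fine_ge0// measure_ge0.
(* Half-open intervals meet end to end without overlap, so the increments of [N a] are values of
   [N]. *)
have ND u v : a <= u -> u <= v -> N a v = N a u + N u v.
  move=> au uv; rewrite /N -fineD//; congr fine.
  rewrite -measureU; [|exact: meas_I|exact: meas_I|].
    by rewrite -setIUr -itv_bndbnd_setU.
  apply/seteqP; split=> // z [[_ /=]]; rewrite in_itv /= => /andP[_ zu] [_ /=].
  by rewrite in_itv /= => /andP[uz _]; have := le_lt_trans zu uz; rewrite ltxx.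
exists (fun x => c * N a x); last first.
  have Nb : N a b <= eps by rewrite -lee_fin fineK.
  have : c * N a b <= c * eps by rewrite ler_wpM2l.
  have : (c + 1) * eps = e by rewrite /eps mulrC divfK//; apply/eqP; lra.
  lra.
split.
- by rewrite /N /mu set_itvoc0 setI0 measure0 mulr0.
- by move=> u v au uv vb; rewrite ler_wpM2l// (ND u v)// lerDl.
- move=> t at_ tb; case: ifPn => tE; last first.
    exists 1 => // u v au ut tv vb _ _.
    by rewrite mul0r (ND u v) ?(le_trans ut)// mulrDr addrAC subrr add0r mulr_ge0.
  have Ut : U t by apply/BU/EB; rewrite inE in tE.
  (* Since [U] is open it contains a ball around [t]; for []u, v]] inside that ball,
     [N u v = v - u]. *)
  move: oU; rewrite openE => /(_ t Ut) /nbhs_ballP[d /= d0 dU].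
  exists d => //.
  move=> u v au ut tv vb tu vt.
  have uv : u <= v by exact: le_trans tv.
  rewrite -mulrBr (ND u v)// (addrC (N a u)) addrK ler_wpM2l//.
  rewrite /N (_ : U `&` _ = `]u, v]%classic).
    rewrite [mu _]lebesgue_measure_itv /= lte_fin; by case: ltP => vu /=; lra.
  apply/setIidr => z /=; rewrite in_itv /= => /andP[uz zv].
  by apply: dU; rewrite /ball /= ltr_norml; apply/andP; split; lra.
Qed.

(** * Fatou's lemma *)

Lemma powR_liminf (R : realType) (p : R) (u : nat -> R) (x e : R) :
  0 < p -> (forall n, 0 <= u n) -> u n @[n --> \oo] --> x -> 0 <= x -> 0 < e ->
  exists n, forall m, (n <= m)%N -> x `^ p <= u m `^ p + e.
Proof.
move=> p0 u0 ux x0 e0.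
(* At [x = 0] the left side is 0; for [x > 0] the power is differentiable, hence continuous. *)
move: x0; rewrite le_eqVlt => /orP[/eqP <-|x0].
  exists 0%N => m _; rewrite powR0 ?gt_eqF//.
  by rewrite addr_ge0 ?powR_ge0// ltW.
have cont : {for x, continuous (@powR R ^~ p)}.
  apply: differentiable_continuous; apply/derivable1_diffP.
  by apply: derivable_powR; rewrite in_itv /= x0.
have : u n `^ p @[n --> \oo] --> x `^ p by exact: (cvg_comp _ _ ux cont).
move=> /cvgrPdist_le /(_ e e0)[n _ un]; exists n => m nm.
by have := un m nm; rewrite /= ler_norml => /andP[_]; lra.
Qed.

Lemma mu_rho_ge0 (R : realType) (X : lmodType R) (rho : X -> R) (p a b : R)
    (f : R -> X) : (0 <= mu_rho rho p a b f)%E.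
Proof.
by apply: le_ereal_inf_tmp => _ [delta _ <-]; apply: ereal_sup_ubound; left.
Qed.

(** Off [E] the tail infimum from [n] on is at most the term of any index [m >= n], so one such [m]
    with bound [M] controls the upper integral of the [n]-th infimum. *)
Lemma mu_rho_fatou (R : realType) (a b p : R) (X : lmodType R) (rho : X -> R)
    (f_ : nat -> R -> X) (f : R -> X) (M : R) :
  a <= b -> 0 < p -> seminorm rho -> cvg_ae rho a b f_ f ->
  (forall n, exists2 m, (n <= m)%N & (mu_rho rho p a b (f_ m) <= M%:E)%E) ->
  (mu_rho rho p a b f <= M%:E)%E.
Proof.
move=> ab p0 [rho0 rhoD rhoZ] [E [_ E0 f_cvg]] f_M.
pose g n t := rho (f_ n t) `^ p.
pose tail n t := [set g m t | m in [set m | (n <= m)%N]].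
have tail_lb n t : has_lbound (tail n t).
  by exists 0 => _ [m _ <-]; exact: powR_ge0.
have tail_ne n t : tail n t !=set0 by exists (g n t), n => /=.
have tail_ge0 n t : 0 <= inf (tail n t).
  by apply: lb_le_inf => // _ [m _ <-]; exact: powR_ge0.
pose h n t := if t \in E then n%:R else inf (tail n t).
apply/lee_addgt0Pr => e e0.
have [|||F F_maj Fb] := @major_monotone_limit _ a b M h
    (fun t => rho (f t) `^ p) ab _ _ _ e e0; last first.
- by apply: le_trans (mu_rho_le_major ab F_maj) _; rewrite -EFinD lee_fin.
- move=> t e' at_ tb e'0.
  have [tE|tE] := boolP (t \in E).
    exists (Num.trunc (rho (f t) `^ p)).+1; rewrite /h tE.
    by have := truncnS_gt (rho (f t) `^ p); lra.
  (* Reverse triangle inequality; the symmetry of [rho] comes from scaling by -1. *)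
  have rho_cvg : rho (f_ n t) @[n --> \oo] --> rho (f t).
    have f0 := f_cvg t; rewrite in_itv /= at_ tb in f0.
    have {f0} := f0 isT; rewrite notin_setE in tE => /(_ tE).
    move=> /cvgrPdist_le f0; apply/cvgrPdist_le => d /f0.
    apply: filterS => n; rewrite sub0r normrN ger0_norm// => nd.
    rewrite ler_norml; apply/andP; split.
      have := rhoD (f_ n t - f t) (f t); rewrite subrK; lra.
    have := rhoD (f t - f_ n t) (f_ n t); rewrite subrK.
    have -> : rho (f t - f_ n t) = rho (f_ n t - f t).
      by rewrite -opprB -[- (_ - _)]scaleN1r rhoZ normrN1 mul1r.
    lra.
  have [n fn] := powR_liminf p0 (fun n => rho0 (f_ n t)) rho_cvg (rho0 _) e'0.
  exists n; rewrite /h (negbTE tE) -lerBlDr; apply: lb_le_inf => //.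
  by move=> _ [m nm <-]; rewrite lerBlDr; exact: fn.
(* [h n] is at most [g m] plus [n] times the indicator of [E]; each summand receives half of [d]. *)
- move=> n d d0; have [m nm fm] := f_M n.
  have d2 : 0 < d / 2 by rewrite divr_gt0.
  have [|F F_maj Fb] := @major_of_mu_rho_lt _ _ rho p a b (f_ m) (M + d / 2) ab.
    by apply: le_lt_trans fm _; rewrite lte_fin ltrDl.
  have [N N_maj Nb] := major_negligible a b (ler0n R n) d2 E0.
  exists (fun x => F x + N x); last by lra.
  apply: major_le (majorD F_maj N_maj) => t at_ tb; rewrite /h.
  case: ifPn => _; first by rewrite lerDr powR_ge0.
  by rewrite addr0; apply: ge_inf => //; exists m.
- move=> n t _ _; rewrite /h; case: ifPn => _; first by rewrite ler_nat.
  apply: lb_le_inf => // _ [m nm <-]; apply: ge_inf => //.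
  by exists m => //=; exact: ltnW.
Qed.

(** * From [mu_rho] to the norm *)

Unset Implicit Arguments.

Theorem theorem7 (R : realType) (a b : R) (hab : a <= b)
    (p : R) (hp : 1 <= p)
    (X : lmodType R) (rho : X -> R) (hrho : seminorm rho)
    (f_ : nat -> R -> X) (hf_ : forall n, Uspace rho p a b (f_ n))
    (f : R -> X) (hf : cvg_ae rho a b f_ f) :
  (Unorm rho p a b f <= limn_einf (fun n => Unorm rho p a b (f_ n)))%E.
Proof.
have p0 : 0 < p by exact: lt_le_trans hp.
have pn0 : p != 0 by rewrite gt_eqF.
pose u n := Unorm rho p a b (f_ n).
have einfs_le n : (einfs u n <= limn_einf u)%E.
  rewrite limn_einf_lim (cvg_lim _ (@cvg_einfs_sup _ u))//.
  by apply: ereal_sup_ubound; exists n.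
have : (0 <= limn_einf u)%E.
  apply: le_trans (einfs_le 0%N).
  by apply: le_ereal_inf_tmp => _ [n _ <-]; exact: poweR_ge0.
(* A lower limit [+oo] makes the claim trivial and [-oo] contradicts nonnegativity, which leaves a
   real [r]. *)
rewrite -/u; case: (limn_einf u) einfs_le => [r| |] // u_le r0; last exact: leey.
apply/lee_addgt0Pr => e e0.
rewrite lee_fin in r0.
have re0 : 0 <= r + e by rewrite addr_ge0 ?(ltW e0).
have mu_le : (mu_rho rho p a b f <= ((r + e) `^ p)%:E)%E.
  apply: (mu_rho_fatou hab p0 hrho hf) => n.
  (* The infimum of the tail is below [r + e], so some [m >= n] has norm below it; taking [p]-th
     powers bounds [mu_rho]. *)
  have : (einfs u n < (r + e)%:E)%E by rewrite (le_lt_trans (u_le n))// lte_fin ltrDl.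
  move=> /ereal_inf_lt[_ [m nm <-] um]; exists m => //.
  rewrite -poweR_EFin -[leLHS]poweRe1 ?mu_rho_ge0//.
  rewrite -[X in (_ `^ X)%E](mulVf pn0) poweRrM.
  apply: gt0_ler_poweR; rewrite ?in_itv /= ?leey ?poweR_ge0 ?lee_fin ?re0 ?(ltW p0) ?(ltW um)//.
have <- : (((r + e) `^ p)%:E `^ p^-1)%E = (r%:E + e%:E)%E.
  by rewrite poweR_EFin -powRrM mulfV// powRr1.
apply: gt0_ler_poweR => //; rewrite ?in_itv /= ?leey ?mu_rho_ge0 ?lee_fin ?powR_ge0//.
by rewrite invr_ge0 ltW.
Qed.
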